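(* Let $K$ be an infinite field and let $f(x_1,\dots,x_m)=\sum_{\sigma\in S_m}\alpha_\sigma x_{\sigma(1)}\cdots x_{\sigma(m)}$ be a multilinear polynomial in $K\langle X\rangle$. Then the following assertions are equivalent: (1) the polynomial $f$ has commutator-degree $r\ge 1$; (2) $f\in Id(UT_r)\setminus Id(UT_{r+1})$; (3) for all $k<r$, and for any $T$ and $t$, we have $\beta^{(k,T,t)}=0$, and there exist $T$ and $t$ such that $\beta^{(r,T,t)}\neq 0$.
   Context: All algebras are associative. $K\langle X\rangle$ is the free associative algebra over $K$ freely generated by a set $X=\{x_1,x_2,\dots\}$ of noncommutative variables. $UT_n=UT_n(K)$ is the algebra of $n\times n$ upper triangular matrices over $K$. For an algebra $A$, $Id(A)$ is the set of $f\in K\langle X\rangle$ that vanish under all substitutions of the variables by elements of $A$. A T-ideal of $K\langle X\rangle$ is an ideal invariant under all endomorphisms of $K\langle X\rangle$; $\langle\mathcal F\rangle^T$ is the smallest T-ideal containing $\mathcal F$. Write $[x,y]=xy-yx$. For $r\ge 1$, $f$ has commutator-degree $r$ if $f\in\langle [x_1,x_2][x_3,x_4]\cdots[x_{2r-1},x_{2r}]\rangle^T$ and $f\notin\langle [x_1,x_2][x_3,x_4]\cdots[x_{2r+1},x_{2r+2}]\rangle^T$. The sums $\beta^{(k,T,t)}$ are defined as follows. For $k\le m$, let $h_1,\dots,h_k\in\{1,\dots,m\}$ with $h_1+\cdots+h_k\le m$, let $t=(t_1,\dots,t_k)$ be a tuple of elements of $\{1,\dots,m\}$ with $t_1<t_2<\cdots<t_k$,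 and let $T=(T_1,\dots,T_k)$ be such that $T_j\subset\{1,\dots,m\}$ for all $j$, $T_i\cap T_j=\emptyset$ if $i\ne j$, and $|T_i|=h_i-1$ for $i\in\{1,\dots,k\}$. For $k\ge 1$, $S(k,T,t)$ is the set of all permutations $\sigma\in S_m$ satisfying: $\sigma(\{1,\dots,h_1-1\})=T_1$; $\sigma(h_1)=t_1$; and, for each $i\in\{2,\dots,k\}$, $\sigma(\{h_1+\cdots+h_{i-1}+1,\dots,h_1+\cdots+h_i-1\})=T_i$ and $\sigma(h_1+\cdots+h_i)=t_i$. Put $\beta^{(k,T,t)}=\sum_{\sigma\in S(k,T,t)}\alpha_\sigma$. For $k=0$, $S(0)=S_m$ and the corresponding sum is $\beta^{(0)}=\sum_{\sigma\in S_m}\alpha_\sigma$.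
   Formalization: In the definition of the sums β^{(k,T,t)}, the condition t_1<t_2<...<t_k is replaced by t_1,...,t_k pairwise distinct; with increasing t the claim fails, e.g. for f=[x_3,x_4][x_1,x_2] and r=2. *)

(* Defs.v *)
From HB Require Import structures.
From mathcomp Require Import all_boot all_fingroup all_algebra.
From mathcomp Require Import finmap.
From mathcomp.multinomials Require Import monalg.

Set Implicit Arguments.
Unset Strict Implicit.
Unset Printing Implicit Defensive.

Import GRing.Theory.

Local Open Scope ring_scope.

Definition infinite_type (T : eqType) : Prop :=
  ~ exists s : seq T, forall x : T, x \in s.

(* The unital free associative algebra K<X>: the monoid algebra over K of the
   free monoid on the countable alphabet nat.  Variables are numbered from 0,
   so [var K i] is the variable written x_(i+1) on paper. *)
Definition freeAlg (K : fieldType) : lalgType K := {malg K[{fmonom nat}]}.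

Definition var (K : fieldType) (i : nat) : freeAlg K := << fmu i >>.

Definition eval (K : fieldType) (A : algType K) (a : nat -> A)
    (f : freeAlg K) : A :=
  \sum_(w <- msupp f) f@_w *: \prod_(i <- (w : seq nat)) a i.

Definition Id (K : fieldType) (A : algType K) (f : freeAlg K) : Prop :=
  forall a : nat -> A, eval a f = 0.

Section UpperTriangular.

Context (K : fieldType) (n : nat).

Definition upper_mx : {pred 'M[K]_n.-1.+1} := fun M => is_trig_mx M^T.

Lemma upper_mxP (M : 'M[K]_n.-1.+1) :
  reflect (forall i j : 'I_n.-1.+1, (j < i)%N -> M i j = 0) (M \in upper_mx).
Proof.
apply: (iffP is_trig_mxP) => H i j lt; first by have := H j i lt; rewrite mxE.
by rewrite mxE; apply: H.
Qed.

Fact upper_mx_subalg : subalg_closed upper_mx.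
Proof.
split.
- by apply/upper_mxP => i j lt; rewrite mxE -val_eqE (gtn_eqF lt).
- move=> c u v /upper_mxP Hu /upper_mxP Hv; apply/upper_mxP => i j lt.
  by rewrite !mxE Hu // Hv // mulr0 addr0.
- move=> u v /upper_mxP Hu /upper_mxP Hv; apply/upper_mxP => i j lt.
  rewrite mxE big1 // => k _; case: (ltnP k i) => ki.
    by rewrite Hu // mul0r.
  by rewrite (Hv k j) ?mulr0 // (leq_trans lt ki).
Qed.

HB.instance Definition _ :=
  GRing.isSubalgClosed.Build K 'M[K]_n.-1.+1 upper_mx upper_mx_subalg.

(* Upper triangular matrices of size n for n >= 1; the size n.-1.+1 is what
   makes the matrices a (nontrivial) ring, and it makes UT 0 the same as UT 1. *)
Record UT : predArgType :=
  MkUT { utval :> 'M[K]_n.-1.+1; _ : utval \in upper_mx }.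

HB.instance Definition _ := [isSub for utval].
HB.instance Definition _ := [Choice of UT by <:].
HB.instance Definition _ := [SubChoice_isSubAlgebra of UT by <:].

End UpperTriangular.

Definition is_Tideal (K : fieldType) (I : freeAlg K -> Prop) : Prop :=
  [/\ I 0,
      forall f g, I f -> I g -> I (f + g),
      forall u f, I f -> I (u * f) /\ I (f * u)
    & forall (phi : {lrmorphism freeAlg K -> freeAlg K}) f, I f -> I (phi f)].

Definition Tideal_gen (K : fieldType) (F : freeAlg K -> Prop)
    (f : freeAlg K) : Prop :=
  forall I : freeAlg K -> Prop,
    is_Tideal I -> (forall g, F g -> I g) -> I f.

Definition comm (R : pzRingType) (a b : R) : R := a * b - b * a.

(* [x_1,x_2][x_3,x_4]...[x_(2r-1),x_(2r)] *)
Definition commprod (K : fieldType) (r : nat) : freeAlg K :=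
  \prod_(i < r) comm (var K i.*2) (var K i.*2.+1).

Definition commutator_degree (K : fieldType) (f : freeAlg K) (r : nat) : Prop :=
  [/\ (1 <= r)%N,
      Tideal_gen (eq (commprod K r)) f
    & ~ Tideal_gen (eq (commprod K r.+1)) f].

Definition multilin (K : fieldType) (m : nat) (alpha : 'S_m -> K) : freeAlg K :=
  \sum_(s : 'S_m) alpha s *: \prod_(i < m) var K (s i).

Section Beta.

Context (K : fieldType) (m k : nat).
Implicit Types (h : 'I_k -> nat) (T : 'I_k -> {set 'I_m}) (t : 'I_k -> 'I_m).

(* The t_i are required to be distinct but not increasing.  With t increasing,
   f = [x_3,x_4][x_1,x_2], which lies in Id(UT_2) but not in Id(UT_3), would have
   all its sums with k = 2 equal to 0: in its monomials 3 and 4 precede 1 and 2,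
   so the only increasing pairs are 3,4 and 1,2, and for these the other
   commutator cancels. *)
Definition admissible h T t : Prop :=
  [/\ (k <= m)%N,
      forall i, (1 <= h i <= m)%N,
      (\sum_i h i <= m)%N,
      injective t
    & (forall i j, i != j -> [disjoint T i & T j])
      /\ (forall i, #|T i| = (h i).-1)].

(* Positions in 'I_m are numbered from 0: the i-th block consists of the h i
   positions starting at h_1 + ... + h_(i-1). *)
Definition block_start h (i : 'I_k) : nat := (\sum_(j < k | (j < i)%N) h j)%N.

Definition perms_of h T t : {set 'S_m} :=
  [set s : 'S_m | [forall i : 'I_k,
     (s @: [set p : 'I_m |
              (block_start h i <= p < block_start h i + (h i).-1)%N] == T i)
     && [forall p : 'I_m,
           (p == block_start h i + (h i).-1 :> nat)%N ==> (s p == t i)]]].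

Definition beta (alpha : 'S_m -> K) h T t : K :=
  \sum_(s in perms_of h T t) alpha s.

End Beta.

(* Main.v *)
Require Import Defs.
From HB Require Import structures.
From mathcomp Require Import all_boot all_fingroup all_algebra.
From mathcomp Require Import finmap zify.
From mathcomp.multinomials Require Import monalg.
From Stdlib Require Import Classical.

(** Write c_r for the product [x_1,x_2]...[x_(2r-1),x_(2r)].  For every
    r >= 1, three properties of the multilinear polynomial f are shown to be
    equivalent, by going around the cycle
      (A) f lies in the T-ideal generated by c_r,
      (B) f is an identity of UT_r,
      (C) all the sums beta with fewer than r blocks vanish.
    Each assertion of the theorem says that f has one of these properties at r
    and lacks it at r + 1, so the theorem follows by using the cycle at r and
    at r + 1.

    (A) implies (B): a commutator of upper triangular matrices is strictly
    upper triangular, and a product of r strictly upper triangular matrices of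
    size r is zero ([Tideal_commprod_Id]).

    (B) implies (C): fix h, T, t with k < r blocks and one permutation s0 in
    the corresponding set; cutting the positions into the blocks gives each
    position p a level, the index of its block.  Substitute for the variable
    that s0 puts at position p the matrix unit of row (level p) and column
    (level (p + 1)).  A monomial s then contributes to the entry (0, k) exactly
    when its matrix units form a path from 0 to k.  Levels never decrease along a
    path, and the path of s uses the same multiset of levels as the path of
    s0, so the two paths coincide; this means that s is in the set, and the
    entry (0, k) of the value of f is the sum beta ([Id_beta_eq0]).

    (C) implies (A): let N(T) be the product of the variables of T in a fixed
    order.  Sorting a word letter by letter from the left gives the telescoping
    sum
      w = N(w) + sum over p of (N(T) x_t - N(T + t)) v,
    where T is the set of the first p letters of w, t is the next letter and
    v is the rest of w.  Summing over the monomials of f, the term N(w) appears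
    with the coefficient beta of zero blocks, which vanishes, and the factor
    N(T) x_t - N(T + t) lies in the commutator ideal.  The coefficient of this
    factor is a combination of shorter words whose sums beta with k blocks are
    sums beta of f with k + 1 blocks, the first of them being (T, t).  After
    r rounds, f is a sum of products of r elements of the commutator ideal
    ([absorbs_words]), and such products are in the T-ideal of c_r because
    the factors between the commutators can be pushed to the right
    ([absorbsMr]). *)

Set Implicit Arguments.
Unset Strict Implicit.
Unset Printing Implicit Defensive.

Import GRing.Theory.

Local Open Scope ring_scope.

(** * Evaluation in the free algebra *)

Lemma malg_scalerAr (K : fieldType) (M : monomType) (c : K) (f g : {malg K[M]}) :
  c *: (f * g) = f * (c *: g).
Proof.
rewrite [f * g]malgME.
rewrite [f * (c *: g)](malgMEw (fsubset_refl (msupp f)) (msuppZ_le c g)).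
rewrite scaler_sumr; apply: eq_bigr => k1 _.
rewrite scaler_sumr; apply: eq_bigr => k2 _.
by rewrite linearZ /= mulrCA; apply/malgP => k; rewrite mcoeffZ !mcoeffU mulrnAr.
Qed.

(** The canonical algebra structure on a monoid algebra is that of a commutative
    monoid; the same ring is given here the structure valid for words. *)
Definition free_algType (K : fieldType) : algType K :=
  HB.pack_for (algType K) {malg K[{fmonom nat}]}
    (GRing.Lalgebra_isAlgebra.Build K {malg K[{fmonom nat}]}
       (@malg_scalerAr K _)).

Lemma rmorph_comm (R S : pzRingType) (f : {rmorphism R -> S}) (a b : R) :
  f (comm a b) = comm (f a) (f b).
Proof. by rewrite /comm rmorphB !rmorphM. Qed.

Section Evaluation.
Context (K : fieldType) (A : algType K) (a : nat -> A).

Let word (w : {fmonom nat}) : A := \prod_(i <- (w : seq nat)) a i.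

Fact word_mmorphism : mmorphism word.
Proof. by split=> [u v|]; rewrite /word ?fm1 ?big_nil // fmM big_cat. Qed.

HB.instance Definition _ := isMultiplicative.Build _ _ word word_mmorphism.

Lemma evalE : eval a =1 mmap (in_alg A) word.
Proof. by move=> f; apply: eq_bigr => w _; rewrite mulr_algl. Qed.

Fact eval_zmod_morphism : zmod_morphism (eval a).
Proof. by move=> f g; rewrite !evalE raddfB. Qed.

Fact eval_scalable : scalable (eval a).
Proof. by move=> c f; rewrite !evalE mmapZ mulr_algl. Qed.

Fact eval_monoid_morphism : monoid_morphism (eval a).
Proof.
have comm_in_alg (g : freeAlg K) m m' : GRing.comm (in_alg A g@_m) (word m').
  by rewrite /GRing.comm mulr_algl mulr_algr.
have [evM ev1] := commr_mmap_is_multiplicative comm_in_alg.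
by split=> [|f g]; rewrite !evalE ?ev1 ?evM.
Qed.

HB.instance Definition _ :=
  GRing.isZmodMorphism.Build _ _ (eval a) eval_zmod_morphism.
HB.instance Definition _ :=
  GRing.isScalable.Build _ _ _ _ (eval a) eval_scalable.
HB.instance Definition _ :=
  GRing.isMonoidMorphism.Build _ _ (eval a) eval_monoid_morphism.

Lemma eval_var i : eval a (var K i) = a i.
Proof. by rewrite evalE mmapU /= scale1r mul1r /word fmU big_seq1. Qed.

Lemma eval_multilin m (alpha : 'S_m -> K) :
  eval a (multilin alpha) = \sum_s alpha s *: \prod_(i < m) a (s i).
Proof.
rewrite /multilin raddf_sum /=; apply: eq_bigr => s _.
by rewrite linearZ rmorph_prod /=; under eq_bigr do rewrite eval_var.
Qed.

Lemma eval_commprod r :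
  eval a (commprod K r) = \prod_(i < r) comm (a i.*2) (a i.*2.+1).
Proof.
rewrite rmorph_prod /=; apply: eq_bigr => i _.
by rewrite rmorph_comm /= !eval_var.
Qed.

End Evaluation.

(** Freeness: an algebra morphism on the free algebra is determined by the images
    of the variables. *)
Lemma lrmorphism_evalE (K : fieldType) (A : algType K)
    (phi : {lrmorphism freeAlg K -> A}) f :
  phi f = eval (fun i => phi (var K i)) f.
Proof.
have monomE (w : {fmonom nat}) :
    << w >> = \prod_(i <- (w : seq nat)) var K i :> freeAlg K.
  case: w => s; elim: s => [|i s IHs]; first by rewrite big_nil -fmoneE.
  rewrite big_cons -IHs [RHS]malgM_def fgmulUU mulr1.
  by congr << _ >>; apply/val_inj; rewrite /= fmM fmU.
rewrite {1}[f]monalgE raddf_sum /=; apply: eq_bigr => w _.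
have -> : << f@_w *g w >> = f@_w *: << w >> :> freeAlg K.
  by apply/malgP => v; rewrite mcoeffZ !mcoeffU mulrnAr mulr1.
by rewrite linearZ /= monomE rmorph_prod.
Qed.

Lemma Id_Tideal (K : fieldType) (A : algType K) : is_Tideal (@Id K A).
Proof.
split=> [a|f g If Ig a|u f If|phi f If a]; first exact: raddf0.
- by rewrite raddfD /= If Ig addr0.
- by split=> a; rewrite rmorphM /= If ?mulr0 ?mul0r.
rewrite -[eval a (phi f)]/((eval a \o phi) f).
by rewrite (lrmorphism_evalE (eval a \o phi)) If.
Qed.

(** * Products of commutators of upper triangular matrices *)

Section UpperTriangularIdentities.
Context (K : fieldType).

Lemma mul_upper_diag n (M N : 'M[K]_n.-1.+1) i :
  M \in @upper_mx K n -> N \in @upper_mx K n -> (M * N) i i = M i i * N i i.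
Proof.
move=> /upper_mxP HM /upper_mxP HN; rewrite mxE (bigD1 i) //= big1 ?addr0 // => k.
rewrite neq_ltn => /orP[ki|ik]; first by rewrite HM ?mul0r.
by rewrite HN ?mulr0.
Qed.

(** The diagonal entries of a commutator cancel, since the diagonal of an upper
    triangular matrix is multiplicative. *)
Lemma comm_UT_strict n (x y : UT K n) (i j : 'I_n.-1.+1) :
  (j <= i)%N -> utval (comm x y) i j = 0.
Proof.
rewrite leq_eqVlt => /orP[/eqP/val_inj->|ji].
  rewrite -[utval _]/(val x * val y - val y * val x) [LHS]mxE [X in _ + X]mxE.
  by rewrite !mul_upper_diag ?(valP x) ?(valP y) // mulrC subrr.
by have /upper_mxP := valP (comm x y); apply.
Qed.

Lemma prod_comm_UT n (x y : nat -> UT K n) q (i j : 'I_n.-1.+1) :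
  (j < i + q)%N -> utval (\prod_(l < q) comm (x l) (y l)) i j = 0.
Proof.
elim: q j => [|q IHq] j; first by rewrite big_ord0 addn0; apply/upper_mxP/(valP 1).
move=> ltj; rewrite big_ord_recr /= mxE big1 // => k _.
have [jk|kj] := leqP j k; first by rewrite comm_UT_strict ?mulr0.
by rewrite IHq ?mul0r // (leq_trans kj) // -ltnS -addnS.
Qed.

Lemma Id_commprod r : (0 < r)%N -> Id (UT K r) (commprod K r).
Proof.
case: r => // r _ a; rewrite eval_commprod; apply/val_inj/matrixP => i j /=.
by rewrite (prod_comm_UT (a \o double) (a \o (fun l => l.*2.+1))) ?mxE //
           (leq_trans (ltn_ord j)) ?leq_addl.
Qed.

Lemma Tideal_commprod_Id r f :
  (0 < r)%N -> Tideal_gen (eq (commprod K r)) f -> Id (UT K r) f.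
Proof.
by move=> r_gt0; apply=> [|_ <-]; [exact: Id_Tideal | exact: Id_commprod].
Qed.

End UpperTriangularIdentities.

(** * Levels of positions relative to a sequence of blocks *)

Section Levels.
Context (k : nat) (h : 'I_k -> nat).

(** Extends [block_start] to the index [k], where it is the end of the last
    block. *)
Definition block_bound n := (\sum_(j < k | (j < n)%N) h j)%N.

(** The number of blocks that end before the position [p]: the index of the block
    of [p], or [k] when [p] is beyond all the blocks. *)
Definition level p := #|[set j : 'I_k | (block_bound j.+1 <= p)%N]|.

Lemma block_boundS (i : 'I_k) : block_bound i.+1 = (block_bound i + h i)%N.
Proof.
rewrite /block_bound (bigD1 i) //= addnC; congr addn; apply: eq_bigl => j.
by rewrite ltnS ltn_neqAle andbC.
Qed.

Lemma block_bound_full : block_bound k = (\sum_i h i)%N.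
Proof. by apply: eq_bigl => j; exact: (ltn_ord j). Qed.

Lemma leq_block_bound : {homo block_bound : a b / (a <= b)%N}.
Proof.
move=> a b leab; rewrite /block_bound [leqRHS](bigID (fun j : 'I_k => (j < a)%N)) /=.
rewrite [X in (_ <= X + _)%N](eq_bigl (fun j : 'I_k => (j < a)%N)) ?leq_addr // => j.
by apply: andb_idl => ja; apply: leq_trans leab.
Qed.

(** [level] is adjoint to [block_bound]; all the other facts about levels come
    from this one. *)
Lemma leq_level n p : (n <= k)%N -> (n <= level p)%N = (block_bound n <= p)%N.
Proof.
case: n => [|n] ltnk; first by rewrite /block_bound big_pred0.
have card_below a (leak : (a <= k)%N) : #|[set j : 'I_k | (j < a)%N]| = a.
  have widen_inj : injective (widen_ord leak).
    by move=> x y /(congr1 val) eqxy; apply: val_inj.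
  rewrite -[RHS](card_ord a) -(card_imset _ widen_inj).
  apply: eq_card => j; rewrite inE; apply/idP/imsetP => [ja|[i _ ->]] /=.
    by exists (Ordinal ja) => //; apply/val_inj.
  exact: (ltn_ord i).
apply/idP/idP => [|le_bp]; last first.
  rewrite -[n.+1](card_below _ ltnk); apply/subset_leq_card/subsetP => j.
  by rewrite !inE => /leq_block_bound/leq_trans; apply.
apply: contraLR; rewrite -!ltnNge => ltpb.
rewrite ltnS -[n in leqRHS](card_below _ (ltnW ltnk)).
apply/subset_leq_card/subsetP => j; rewrite !inE; apply: contraLR.
by rewrite -!ltnNge => lenj; rewrite (leq_trans ltpb) // leq_block_bound.
Qed.

Lemma level_leq p : (level p <= k)%N.
Proof. by rewrite -[leqRHS]card_ord max_card. Qed.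

Lemma level_homo : {homo level : p q / (p <= q)%N}.
Proof.
move=> p q lepq; rewrite leq_level ?level_leq // (leq_trans _ lepq) //.
by rewrite -leq_level ?level_leq.
Qed.

Lemma level_eq (i : 'I_k) p :
  (level p == i) = (block_bound i <= p < block_bound i.+1)%N.
Proof.
have ltik := ltn_ord i.
by rewrite eqn_leq leqNgt !leq_level ?(ltnW ltik) // -ltnNge andbC.
Qed.

Hypothesis h_gt0 : forall i, (0 < h i)%N.

(** The inner positions of a block are those where the level stays the same, and
    its last position is the one where the level goes up ([block_end]). *)
Lemma in_block (i : 'I_k) p :
  (block_start h i <= p < block_start h i + (h i).-1)%N =
  (level p == i) && (level p.+1 == i).
Proof.
rewrite !level_eq block_boundS -[block_start h i]/(block_bound i).
by have := h_gt0 i; lia.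
Qed.

Lemma block_end (i : 'I_k) p :
  (p == block_start h i + (h i).-1 :> nat)%N =
  (level p == i) && (level p.+1 == i.+1).
Proof.
rewrite level_eq [level p.+1 == _]eqn_leq leq_level //.
rewrite block_boundS -[block_start h i]/(block_bound i).
have := h_gt0 i.
have [lei1k|] := ltnP i.+1 k; last first.
  by move=> lek; rewrite (leq_trans (level_leq _) lek); lia.
rewrite [(level p.+1 <= _)%N]leqNgt leq_level // -ltnNge.
have := block_boundS (Ordinal lei1k); have := block_boundS i.
by have := h_gt0 (Ordinal lei1k) => /=; lia.
Qed.

End Levels.

(** * Permutations with the same blocks *)

Section LevelPermutations.
Context (m k : nat) (h : 'I_k -> nat) (h_gt0 : forall i, (0 < h i)%N).
Implicit Types (s : 'S_m) (T : 'I_k -> {set 'I_m}) (t : 'I_k -> 'I_m).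

Definition step p := (level h p, level h p.+1).

Lemma perms_ofP s T t :
  reflect (forall i : 'I_k,
             s @: [set p : 'I_m | step p == (i : nat, i : nat)] = T i
             /\ forall p : 'I_m, step p = (i : nat, i.+1) -> s p = t i)
          (s \in perms_of h T t).
Proof.
have blockE (i : 'I_k) :
    [set p : 'I_m | (block_start h i <= p < block_start h i + (h i).-1)%N] =
    [set p : 'I_m | step p == (i : nat, i : nat)].
  by apply/setP => p; rewrite !inE in_block // xpair_eqE.
rewrite inE; apply: (iffP forallP) => Hs i.
  have /andP[/eqP <- /forallP He] := Hs i; split; first by rewrite blockE.
  move=> p [/eqP pi /eqP pi1]; apply/eqP/(implyP (He p)).
  by rewrite block_end // pi.
have [<- He] := Hs i; rewrite blockE eqxx /=.
apply/forallP => p; apply/implyP; rewrite block_end // => /andP[/eqP pi /eqP pi1].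
by apply/eqP/He; congr pair.
Qed.

Lemma level_cases p : (level h p < k)%N ->
  exists i : 'I_k, level h p = i /\ (level h p.+1 = i \/ level h p.+1 = i.+1).
Proof.
move=> ltk; exists (Ordinal ltk); split=> //=.
have := in_block h_gt0 (Ordinal ltk) p; have := block_end h_gt0 (Ordinal ltk) p.
have := level_eq h (Ordinal ltk) p; rewrite block_boundS /= eqxx.
rewrite -[block_start h _]/(block_bound h _) /=.
move=> /esym/andP[-> ltp] eq_end eq_in.
have [lt|ge] := ltnP p (block_bound h (level h p) + (h (Ordinal ltk)).-1).
  by left; apply/eqP; rewrite -eq_in lt.
right; apply/eqP; rewrite -eq_end eqn_leq ge andbT.
by have := h_gt0 (Ordinal ltk); lia.
Qed.

(** A letter that one of the two permutations puts inside the blocks is an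
    element of some [T i] or one of the [t i], and this tells its step for
    both. *)
Lemma perms_of_step_eq s s' T t (p q : 'I_m) :
  s \in perms_of h T t -> s' \in perms_of h T t ->
  (level h q < k)%N -> s p = s' q -> step p = step q.
Proof.
move=> /perms_ofP Hs /perms_ofP Hs' /level_cases[i [qi]].
have [[HB He] [HB' He']] := (Hs i, Hs' i).
case=> qi1 eq_sp; have {eq_sp} := esym eq_sp; last first.
  rewrite He' -?(He q); [|by congr pair..].
  by move=> /perm_inj ->.
move=> eq_sp; have: s' q \in T i by rewrite -HB' imset_f // inE /step qi qi1.
rewrite eq_sp -HB mem_imset ?inE; last exact: perm_inj.
by move=> /eqP ->; rewrite /step qi qi1.
Qed.

Lemma step_top p : (k <= level h p)%N -> step p = (k, k).
Proof.
move=> lekp; congr pair; apply/eqP; rewrite eqn_leq level_leq //.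
by rewrite (leq_trans lekp) // level_homo.
Qed.

(** Once one permutation [s0] of the set is known, the sets [T] and [t] can be
    forgotten: being in the set means preserving the steps of the letters
    relative to [s0]. *)
Lemma perms_of_steps s0 s T t : s0 \in perms_of h T t ->
  (s \in perms_of h T t) = [forall p, step ((s0^-1)%g (s p)) == step p].
Proof.
move=> s0P; apply/idP/forallP => [sP p|eq_step].
  have sE : s0 ((s0^-1)%g (s p)) = s p by rewrite permKV.
  have [ltk|geqk] := ltnP (level h p) k; first exact/eqP/(perms_of_step_eq s0P sP).
  have [ltk'|geqk'] := ltnP (level h ((s0^-1)%g (s p))) k.
    by apply/eqP/esym/(perms_of_step_eq sP s0P ltk').
  by rewrite !step_top.
have sE p : s p = s0 ((s0^-1)%g (s p)) by rewrite permKV.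
apply/perms_ofP => i; have [<- He] := perms_ofP _ _ _ s0P i; split.
  apply/eqP; rewrite eqEcard !card_imset ?leqnn ?andbT; try exact: perm_inj.
  apply/subsetP => _ /imsetP[p pB ->]; rewrite sE mem_imset; last exact: perm_inj.
  by move: pB; rewrite !inE (eqP (eq_step p)).
by move=> p pE; rewrite sE He // (eqP (eq_step p)).
Qed.

End LevelPermutations.

(** * Matrix units along a path of levels *)

(** A product of matrix units is read as a walk: each column has to be the next
    row, and comparing the two sequences says all these equalities at once,
    together with the conditions at both ends. *)
Lemma prod_delta_mx (R : pzRingType) n (I : Type) (w : seq I) (u v : I -> 'I_n.+1)
    (i j : 'I_n.+1) :
  (\prod_(x <- w) delta_mx (u x) (v x) : 'M[R]_n.+1) i j =
  (i :: map v w == rcons (map u w) j)%:R.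
Proof.
elim: w i => [|x w IHw] i; first by rewrite big_nil mxE eqseq_cons andbT.
rewrite big_cons; set M := \prod_(x <- w) _ in IHw *.
rewrite mxE (bigD1 (v x)) //= big1 => [|l /negPf lv]; last first.
  by rewrite mxE lv andbF mul0r.
by rewrite addr0 mxE eqxx andbT IHw eqseq_cons -natrM mulnb.
Qed.

Section LevelPaths.
Context (m k : nat) (h : 'I_k -> nat) (h_gt0 : forall i, (0 < h i)%N).
Hypothesis sum_h : (\sum_i h i <= m)%N.

Lemma level0 : level h 0 = 0%N.
Proof.
apply/eqP; rewrite -leqn0 leqNgt.
have [k0|k_gt0] := posnP k; first by rewrite -ltnNge ltnS -[leqRHS]k0 level_leq.
rewrite leq_level // -ltnNge (block_boundS h (Ordinal k_gt0)).
by rewrite addn_gt0 h_gt0 orbT.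
Qed.

Lemma level_max : level h m = k.
Proof.
by apply/eqP; rewrite eqn_leq level_leq leq_level // block_bound_full.
Qed.

(** Consecutive levels along a path do not decrease, so a path lists its levels
    in increasing order; a permutation does not change their multiset, so it can
    only be the path of the identity. *)
Lemma level_path (tau : 'S_m) :
  (0%N :: [seq level h (tau p).+1 | p <- enum 'I_m] ==
     rcons [seq level h (tau p) | p <- enum 'I_m] k) =
  [forall p, step h (tau p) == step h p].
Proof.
have base : 0%N :: [seq level h p.+1 | p : 'I_m <- enum 'I_m] =
            rcons [seq level h p | p : 'I_m <- enum 'I_m] k.
  pose idm := [seq val p | p <- enum 'I_m].
  have mapE (f : nat -> nat) : [seq f (val p) | p <- enum 'I_m] = map f idm.
    by rewrite /idm -map_comp.
  rewrite (mapE (fun p => level h p.+1)) (mapE (level h)) /idm val_enum_ord.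
  have <- : map (level h) (iota 0 m.+1) = rcons (map (level h) (iota 0 m)) k.
    by rewrite -addn1 iotaD map_cat /= level_max cats1.
  by rewrite /= level0 (iotaDl 1 0) -map_comp.
have sorted_tau : sorted leq [seq level h (tau p) | p <- enum 'I_m] ->
    [seq level h (tau p) | p <- enum 'I_m] = [seq level h p | p : 'I_m <- enum 'I_m].
  move=> sorted_tau; apply: (sorted_eq leq_trans anti_leq) => //.
    rewrite (map_comp (level h) val) val_enum_ord; apply: homo_sorted (iota_sorted 0 m).
    exact: level_homo.
  rewrite (map_comp (fun p : 'I_m => level h p) tau); apply: perm_map.
  apply: uniq_perm; rewrite ?(map_inj_uniq perm_inj) ?enum_uniq // => p.
  by rewrite -[p](permKV tau) (mem_map perm_inj) !mem_enum.
apply/eqP/forallP => [E p|eq_step]; last first.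
  have eq_lvl p := congr1 fst (eqP (eq_step p)).
  have eq_lvl1 p := congr1 snd (eqP (eq_step p)).
  by rewrite (eq_map eq_lvl) (eq_map eq_lvl1).
have eq_lvl : [seq level h (tau q) | q <- enum 'I_m] =
              [seq level h q | q : 'I_m <- enum 'I_m].
  apply: sorted_tau.
  apply/(sortedP 0%N) => l; rewrite size_map size_enum_ord => ltlm.
  have := congr1 (fun w => nth 0%N w l.+1) E.
  rewrite /= nth_rcons size_map size_enum_ord ltlm => <-.
  have ltlm' := ltnW ltlm.
  rewrite !(nth_map (Ordinal ltlm')) -?enumT ?size_enum_ord //.
  by apply: level_homo.
have /eqP := E; rewrite eq_lvl -base eqseq_cons => /andP[_ /eqP /eq_in_map eq_lvl1].
move/eq_in_map: eq_lvl => eq_lvl.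
by rewrite /step eq_lvl ?eq_lvl1 ?mem_enum.
Qed.

End LevelPaths.

(** * Identities of triangular matrices make the block sums vanish *)

Section IdentityImpliesVanishing.
Context (K : fieldType) (m k r : nat) (h : 'I_k -> nat).
Hypothesis ltkr : (k < r)%N.

Fact inord_level q : (q <= k)%N -> (inord q : 'I_r.-1.+1) = q :> nat.
Proof.
move=> leqk; apply: inordK; rewrite prednK; last exact: leq_ltn_trans ltkr.
exact: leq_ltn_trans ltkr.
Qed.

Fact level_mx_upper p :
  delta_mx (inord (level h p)) (inord (level h p.+1)) \in @upper_mx K r.
Proof.
apply/upper_mxP => i j ltji; rewrite mxE; case: andP => // -[/eqP ip /eqP jp].
by move: ltji; rewrite ip jp !inord_level ?level_leq // ltnNge level_homo.
Qed.

Definition level_UT p : UT K r := MkUT (level_mx_upper p).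

Lemma prod_level_UT (tau : 'S_m) :
  (forall i, (0 < h i)%N) -> (\sum_i h i <= m)%N ->
  utval (\prod_p level_UT (tau p)) ord0 (inord k) =
  [forall p, step h (tau p) == step h p]%:R.
Proof.
move=> h_gt0 sum_h; rewrite -level_path //.
have -> : utval (\prod_p level_UT (tau p)) =
    \prod_(p <- enum 'I_m) utval (level_UT (tau p)).
  by rewrite [LHS](rmorph_prod (val : UT K r -> _)) [index_enum _]unlock -enumT.
rewrite prod_delta_mx.
rewrite -(inj_eq (inj_map val_inj)) /= map_rcons -!map_comp /= inord_level //.
by congr (_ :: _ == rcons _ _)%:R; apply: eq_map => p /=;
  rewrite inord_level ?level_leq.
Qed.

Lemma Id_beta_eq0 T (t : 'I_k -> 'I_m) (alpha : 'S_m -> K) :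
  admissible h T t -> Id (UT K r) (multilin alpha) -> beta alpha h T t = 0.
Proof.
move=> [_ h_bounds sum_h _ _] fId.
have h_gt0 i : (0 < h i)%N by case/andP: (h_bounds i).
have [s0 s0P|no_perm] := pickP [in perms_of h T t]; last by rewrite /beta big_pred0.
(* The variable at position p of the monomial s0 goes to the p-th matrix unit. *)
pose a l : UT K r :=
  if insub l is Some p then level_UT ((s0^-1)%g (p : 'I_m)) else 0.
have a_prod (s : 'S_m) :
    utval (\prod_p a (s p)) ord0 (inord k) = (s \in perms_of h T t)%:R.
  rewrite (perms_of_steps h_gt0 s s0P).
  have -> : \prod_p a (s p) = \prod_p level_UT ((s * s0^-1)%g p).
    by apply: eq_bigr => p _; rewrite /a valK permM.
  by rewrite prod_level_UT //; under eq_forallb do rewrite permM.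
have evalE : utval (eval a (multilin alpha)) =
    \sum_s alpha s *: utval (\prod_p a (s p)).
  by rewrite eval_multilin [LHS](raddf_sum (val : UT K r -> _)).
have := fId a => /(congr1 (fun M => utval M ord0 (inord k))).
rewrite evalE summxE /= [RHS]mxE => <-; rewrite /beta [LHS]big_mkcond.
by apply: eq_bigr => s _; rewrite mxE a_prod; case: ifP; rewrite ?mulr1 ?mulr0.
Qed.

End IdentityImpliesVanishing.

(** * Powers of the commutator ideal *)

Definition is_ideal (R : pzRingType) (J : R -> Prop) : Prop :=
  [/\ J 0, forall f g, J f -> J g -> J (f + g)
    & forall u f, J f -> J (u * f) /\ J (f * u)].

(** Moves a factor from the left of a commutator to its right, modulo a
    commutator without such a factor. *)
Lemma mulr_comm_l (R : pzRingType) (u a b : R) :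
  u * comm a b = comm (u * a) b - comm u b * a.
Proof.
by rewrite /comm mulrBr mulrBl !mulrA opprB addrA subrK.
Qed.

Lemma mulr_swap_comm (R : pzRingType) (x p a b : R) :
  x * p - a * (x * b) = x * (p - a * b) - comm a x * b.
Proof. by rewrite /comm mulrBr mulrBl !mulrA opprB addrA subrK. Qed.

Section Absorption.
Context (R : pzRingType) (J : R -> Prop).
Implicit Types (G u : R).

(** For an ideal [J], this says that [J] contains the product of [G] with the
    [n]-th power of the commutator ideal; the definition asks it only for
    adjacent commutators, and [absorbsMr] provides the factors in between. *)
Fixpoint absorbs n G : Prop :=
  if n is n'.+1 then forall a b : R, absorbs n' (G * comm a b) else J G.

Hypothesis J_ideal : is_ideal J.

Lemma absorbs0 n : absorbs n 0.
Proof. by elim: n => [|n IHn] /=; [case: J_ideal | move=> a b; rewrite mul0r]. Qed.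

Lemma absorbsD n G1 G2 : absorbs n G1 -> absorbs n G2 -> absorbs n (G1 + G2).
Proof.
elim: n G1 G2 => [|n IHn] G1 G2 /=; first by case: J_ideal => _ JD _; exact: JD.
by move=> H1 H2 a b; rewrite mulrDl; apply: IHn.
Qed.

Lemma absorbsMl n u G : absorbs n G -> absorbs n (u * G).
Proof.
elim: n G => [|n IHn] G /=; first by case: J_ideal => _ _ JM /(JM u)[].
by move=> HG a b; rewrite -mulrA; apply: IHn.
Qed.

Lemma absorbsN n G : absorbs n G -> absorbs n (- G).
Proof. by rewrite -mulN1r; apply: absorbsMl. Qed.

Lemma absorbsB n G1 G2 : absorbs n G1 -> absorbs n G2 -> absorbs n (G1 - G2).
Proof. by move=> H1 H2; apply/absorbsD/absorbsN. Qed.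

Lemma absorbs_sum n (I : Type) (r : seq I) (P : pred I) (f : I -> R) :
  (forall i, P i -> absorbs n (f i)) -> absorbs n (\sum_(i <- r | P i) f i).
Proof. by move=> Hf; elim/big_ind: _ => //; [exact: absorbs0 | exact: absorbsD]. Qed.

(** A factor [u] is pushed through all the commutators to the right end, where
    the ideal takes it. *)
Lemma absorbsMr n G u : absorbs n G -> absorbs n (G * u).
Proof.
elim: n G u => [|n IHn] G u /=; first by case: J_ideal => _ _ JM /(JM u)[].
move=> HG a b; rewrite -mulrA mulr_comm_l mulrBr !mulrA.
by apply: absorbsB => //; apply: IHn.
Qed.

(** Reordering a monomial changes it by an element of the commutator ideal, which
    uses up one of the [n.+1] commutators. *)
Lemma absorbs_perm n G (V : eqType) (x : V -> R) (s1 s2 : seq V) :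
  absorbs n.+1 G -> perm_eq s1 s2 ->
  absorbs n (G * (\prod_(y <- s1) x y - \prod_(y <- s2) x y)).
Proof.
elim: s1 s2 G => [|y s1 IHs] s2 G HG eq12.
  move: eq12; rewrite perm_sym => /perm_nilP ->.
  by rewrite subrr mulr0; exact: absorbs0.
have y_s2 : y \in s2 by rewrite -(perm_mem eq12) mem_head.
case/splitPr: s2 / y_s2 eq12 => s t.
rewrite perm_sym -cat1s perm_catCA perm_cons perm_sym => eq1.
rewrite !big_cons big_cat big_cons /= mulr_swap_comm -big_cat /=.
rewrite (mulrBr G) !(mulrA G).
apply: absorbsB; first by apply: IHs => //; apply: absorbsMr.
exact/absorbsMr/HG.
Qed.

Lemma absorbs_prod n G :
  (forall a b : nat -> R, J (G * \prod_(i < n) comm (a i) (b i))) -> absorbs n G.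
Proof.
elim: n G => [|n IHn] G HG /=.
  by have := HG (fun=> 0) (fun=> 0); rewrite big_ord0 mulr1.
move=> a b; apply: IHn => a' b'.
have := HG (fun i => if i is i'.+1 then a' i' else a)
           (fun i => if i is i'.+1 then b' i' else b).
by rewrite big_ord_recl mulrA.
Qed.

End Absorption.

Lemma absorbs_commprod (K : fieldType) (J : freeAlg K -> Prop) r :
  is_Tideal J -> J (commprod K r) ->
  absorbs (R := free_algType K) J r 1.
Proof.
move=> J_Tideal Jc; apply: absorbs_prod => a b; rewrite mul1r.
pose c l : free_algType K := if odd l then b l./2 else a l./2.
pose phi : {lrmorphism freeAlg K -> free_algType K} := eval c.
have phi_c : phi (commprod K r) = \prod_(i < r) comm (a i) (b i).
  rewrite [LHS]eval_commprod; apply: eq_bigr => i _.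
  by rewrite /c /= odd_double /= doubleK uphalf_double.
by case: J_Tideal => _ _ _ /(_ phi _ Jc); rewrite phi_c.
Qed.

(** * Combinations of words with vanishing block sums *)

Section WordBlocks.
Context (V : finType).
Implicit Types (w : seq V) (T : {set V}) (bs : seq (nat * {set V} * V)).

(** Cuts [w] along the blocks [bs]: a triple (p, T, t) stands for p letters
    forming the set T followed by the letter t.  This is the recursive form of
    the condition that defines [perms_of]. *)
Fixpoint matches bs w : bool :=
  if bs is (p, T, t) :: bs' then
    [&& [set y in take p w] == T, onth w p == Some t & matches bs' (drop p.+1 w)]
  else true.

Context (K : fieldType) (A : algType K) (J : A -> Prop).
Hypothesis J_ideal : is_ideal J.
Context (x : V -> A) (I : finType) (alpha : I -> K).

Lemma onth_take_drop w p t : onth w p = Some t ->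
  take p.+1 w = rcons (take p w) t /\ drop p w = t :: drop p.+1 w.
Proof.
elim: w p => [|y w IHw] [|p] //=; first by case=> ->; rewrite take0 drop0.
by move/IHw => [-> ->].
Qed.

Lemma word_split (M : {set V}) w p T t :
  perm_eq w (enum M) -> [set y in take p w] = T -> onth w p = Some t ->
  t \notin T /\ perm_eq (drop p.+1 w) (enum (M :\: (t |: T))).
Proof.
move=> wM <-{T} /onth_take_drop[_ dropE].
have wE : w = take p w ++ t :: drop p.+1 w by rewrite -dropE cat_take_drop.
set u := take p w in wE *; set v := drop p.+1 w in wE *.
have uniq_utv : uniq (u ++ t :: v) by rewrite -wE (perm_uniq wM) enum_uniq.
have mem_utv y : (y \in u ++ t :: v) = (y \in M).
  by rewrite -wE (perm_mem wM) mem_enum.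
move: uniq_utv; rewrite cat_uniq /= negb_or.
move=> /and3P[_ /andP[tNu uvN] /andP[tNv uniq_v]].
split; first by rewrite inE.
apply: uniq_perm; rewrite ?enum_uniq // => y.
rewrite mem_enum !inE -mem_utv mem_cat inE.
have [yv|yNv] := boolP (y \in v).
  rewrite !orbT andbT; apply/esym; rewrite negb_or; apply/andP; split.
    by apply: contraNneq tNv => <-.
  by apply: contraNN uvN => yu; apply/hasP; exists y.
by case: (y == t); case: (y \in u).
Qed.

(** The induction peels off one block at a time.  The factor [G] accumulates the
    elements of the commutator ideal already split off, [P] and [w] select the
    monomials that begin with the chosen blocks and what remains of them, and
    [M] is the set of the remaining letters. *)
Lemma absorbs_words n (G : A) (M : {set V}) (P : pred I) (w : I -> seq V) :
  absorbs J n G ->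
  (forall i, P i -> perm_eq (w i) (enum M)) ->
  (forall bs, (size bs < n)%N -> \sum_(i | P i && matches bs (w i)) alpha i = 0) ->
  J (G * \sum_(i | P i) alpha i *: \prod_(y <- w i) x y).
Proof.
elim: n G M P w => [|n IHn] G M P w HG wM vanish.
  by case: J_ideal => _ _ JM; apply: (JM _ _ HG).2.
pose N (T : {set V}) : A := \prod_(y <- enum T) x y.
(* The word w i with its first p letters sorted. *)
pose Z p i := N [set y in take p (w i)] * \prod_(y <- drop p (w i)) x y.
have size_w i : P i -> size (w i) = #|M| by move/wM/perm_size; rewrite -cardE.
have telescope i : P i ->
    \prod_(y <- w i) x y = N M - \sum_(0 <= p < #|M|) (Z p.+1 i - Z p i).
  move=> Pi; rewrite telescope_sumr // /Z -(size_w i Pi).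
  rewrite take_size drop_size take0 drop0 big_nil mulr1 /N.
  have -> : [set y in w i] = M.
    by apply/setP => y; rewrite inE (perm_mem (wM i Pi)) mem_enum.
  have -> : [set y in [::]] = set0 :> {set V} by apply/setP => y; rewrite !inE.
  by rewrite enum_set0 big_nil mul1r opprB addrC subrK.
under eq_bigr => i Pi do rewrite telescope // scalerBr scaler_sumr.
rewrite sumrB -scaler_suml.
(* The sum over no block is the coefficient of the sorted word. *)
have := vanish [::] isT; under eq_bigl do rewrite andbT.
move=> ->; rewrite scale0r sub0r mulrN exchange_big /= mulr_sumr.
apply: (absorbsN J_ideal (n := 0)); rewrite big_nat.
apply: (absorbs_sum J_ideal (n := 0)) => p /andP[_ ltpM].
(* Words with the same first p letters and the same next letter share the factor
   that the telescoping produces at p. *)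
rewrite (partition_big (fun i => ([set y in take p (w i)], onth (w i) p)) xpredT) //=.
rewrite mulr_sumr; apply: (absorbs_sum J_ideal (n := 0)) => -[T [t|]] _ /=; last first.
  rewrite big_pred0 ?mulr0; first exact: (absorbs0 J_ideal 0).
  move=> i; apply/negP => /andP[Pi /eqP[_ no_t]].
  by have := onthTE (w i) p; rewrite no_t size_w // ltpM.
pose P' i := P i && (([set y in take p (w i)], onth (w i) p) == (T, Some t)).
have [i0 /andP[Pi0 /eqP[T0 t0]]|noP'] := pickP P'; last first.
  by rewrite big_pred0 ?mulr0 //; exact: (absorbs0 J_ideal 0).
have [tT _] := word_split (wM i0 Pi0) T0 t0.
have -> : G * (\sum_(i | P' i) alpha i *: (Z p.+1 i - Z p i)) =
    G * (N (t |: T) - N T * x t) *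
    \sum_(i | P' i) alpha i *: \prod_(y <- drop p.+1 (w i)) x y.
  rewrite -mulrA; congr (G * _); rewrite mulr_sumr.
  apply: eq_bigr => i /andP[Pi /eqP[Ti ti]].
  rewrite -scalerAr; congr (_ *: _); rewrite mulrBl /Z Ti -mulrA.
  have [takeE dropE] := onth_take_drop ti.
  rewrite dropE big_cons takeE; congr (N _ * _ - _).
  by apply/setP => y; rewrite -Ti !inE mem_rcons inE.
apply: (IHn _ (M :\: (t |: T))) => [|i /andP[Pi /eqP[Ti ti]]|bs ltbs].
- rewrite /N.
  have enumE : perm_eq (enum (t |: T)) (rcons (enum T) t).
    apply: uniq_perm; rewrite ?rcons_uniq ?mem_enum ?tT ?enum_uniq // => y.
    by rewrite mem_rcons mem_enum !inE mem_enum.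
  have := absorbs_perm J_ideal x HG enumE.
  by rewrite -cats1 big_cat big_seq1.
- by have [] := word_split (wM i Pi) Ti ti.
rewrite -[RHS](vanish ((p, T, t) :: bs)) //; apply: eq_bigl => i.
by rewrite /P' /= xpair_eqE -!andbA.
Qed.

End WordBlocks.

(** * The block sums of a multilinear polynomial *)

Section MatchesPermutations.
Context (m : nat).
Implicit Types (s : 'S_m) (bs : seq (nat * {set 'I_m} * 'I_m)).

Definition word_of s := [seq s p | p <- enum 'I_m].

Definition block_sizes (V : finType) (bs : seq (nat * {set V} * V)) :=
  [seq b.1.1.+1 | b <- bs].

Lemma matchesP (V : finType) (bs : seq (nat * {set V} * V)) (w : seq V) :
  reflect (forall i p T t, onth bs i = Some (p, T, t) ->
             let v := drop (sumn (take i (block_sizes bs))) w in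
             [set y in take p v] = T /\ onth v p = Some t)
          (matches bs w).
Proof.
elim: bs w => [|[[p T] t] bs IHbs] w /=; first by constructor=> -[].
apply: (iffP and3P) => [[/eqP TE /eqP tE /IHbs Hbs]|Hbs].
  case=> [|i] p' T' t' /=; first by case=> <- <- <-; rewrite drop0.
  by rewrite addnC -drop_drop => /Hbs.
have [TE tE] := Hbs 0%N _ _ _ erefl; rewrite drop0 in TE tE.
rewrite TE tE; split=> //; apply/IHbs => i p' T' t' /(Hbs i.+1).
by rewrite /= addnC -drop_drop.
Qed.

Lemma matches_size (V : finType) (bs : seq (nat * {set V} * V)) (w : seq V) :
  matches bs w -> (sumn (block_sizes bs) <= size w)%N.
Proof.
elim: bs w => [|[[p T] t] bs IHbs] w //= /and3P[_ /eqP tE /IHbs].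
have := onthTE w p; rewrite tE size_drop /= => /esym ltpw.
by lia.
Qed.

Lemma mem_take_drop_ord a b (q : 'I_m) :
  (q \in take b (drop a (enum 'I_m))) = (a <= q < a + b)%N.
Proof.
rewrite -(mem_map val_inj) map_take map_drop val_enum_ord drop_iota take_iota.
by rewrite mem_iota; have := ltn_ord q => /=; lia.
Qed.

Lemma take_drop_word_of s a b :
  [set y in take b (drop a (word_of s))] =
  s @: [set q : 'I_m | (a <= q < a + b)%N].
Proof.
rewrite -map_drop -map_take; apply/setP => y; rewrite inE.
by apply/mapP/imsetP => -[q qab ->]; exists q => //; move: qab;
  rewrite inE mem_take_drop_ord.
Qed.

Lemma onth_word_of s a b t :
  (onth (drop a (word_of s)) b == Some t) =
  (a + b < m)%N && [forall q : 'I_m, (q == a + b :> nat)%N ==> (s q == t)].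
Proof.
have [ltm|gem] /= := ltnP (a + b) m; last first.
  by rewrite onth_default // size_drop size_map size_enum_ord; lia.
have -> : onth (drop a (word_of s)) b = Some (s (Ordinal ltm)).
  rewrite onthE (nth_map (s (Ordinal ltm))); last first.
    by rewrite size_drop size_map size_enum_ord ltn_subRL.
  rewrite nth_drop (nth_map (Ordinal ltm)); last by rewrite size_enum_ord.
  by congr (Some (s _)); apply: ord_inj; rewrite nth_enum_ord.
apply/idP/forallP => [/eqP[<-] q|/(_ (Ordinal ltm))]; last first.
  by rewrite eqxx => /eqP ->.
by apply/implyP => /eqP qE; apply/eqP; congr (s _); apply: val_inj.
Qed.

Lemma card_ord_interval a b : (a + b <= m)%N ->
  #|[set q : 'I_m | (a <= q < a + b)%N]| = b.
Proof.
move=> leabm; rewrite cardsE -(eq_card (mem_take_drop_ord a b)).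
rewrite (card_uniqP _) ?take_uniq ?drop_uniq ?enum_uniq //.
by rewrite size_takel // size_drop size_enum_ord; lia.
Qed.

(** A permutation that realizes the blocks forces the [T i] to be disjoint and of
    the right size and the [t i] to be distinct, so the vanishing of the
    admissible sums gives that of all the sums over [matches]. *)
Lemma perms_of_admissible k (h : 'I_k -> nat) T t s :
  (forall i, (0 < h i)%N) -> (\sum_i h i <= m)%N ->
  s \in perms_of h T t -> admissible h T t.
Proof.
move=> h_gt0 sum_h sP.
have bound_m (i : 'I_k) : (block_start h i + h i <= m)%N.
  rewrite -[block_start h i]/(block_bound h i) -block_boundS.
  by rewrite (leq_trans _ sum_h) // -block_bound_full leq_block_bound.
split=> [|i|//|i j eq_t|].
- rewrite (leq_trans _ sum_h) // -[leqLHS]card_ord -sum1_card.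
  by apply: leq_sum.
- by rewrite h_gt0 (leq_trans _ (bound_m i)) ?leq_addl.
- have ltm (l : 'I_k) : (block_start h l + (h l).-1 < m)%N.
    by rewrite (leq_trans _ (bound_m l)) // ltn_add2l prednK.
  have step_end (l : 'I_k) : step h (Ordinal (ltm l)) = (l : nat, l.+1).
    have := block_end h_gt0 l (Ordinal (ltm l)); rewrite eqxx.
    by rewrite /step => /esym/andP[/eqP -> /eqP ->].
  have sE l : s (Ordinal (ltm l)) = t l.
    by have [_ ->] := perms_ofP h_gt0 s T t sP l; rewrite ?step_end.
  have := step_end i.
  rewrite (perm_inj (etrans (sE i) (etrans eq_t (esym (sE j))))).
  by rewrite step_end => -[/val_inj].
split=> [i j neq_ij|i].
  have [<- _] := perms_ofP h_gt0 s T t sP i.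
  have [<- _] := perms_ofP h_gt0 s T t sP j.
  rewrite imset_disjoint; last exact: perm_inj.
  apply/pred0P => p /=; rewrite !inE.
  apply/negP => /andP[/eqP -> /eqP[/val_inj eq_ij]].
  by rewrite eq_ij eqxx in neq_ij.
move: sP; rewrite inE => /forallP/(_ i)/andP[/eqP <- _].
rewrite card_imset ?card_ord_interval //; last exact: perm_inj.
by rewrite (leq_trans _ (bound_m i)) // leq_add2l leq_pred.
Qed.

Lemma sumn_take (ns : seq nat) n :
  sumn (take n ns) = (\sum_(j < size ns | (j < n)%N) nth 0 ns j)%N.
Proof.
elim: ns n => [|x ns IHns] n; first by rewrite big_ord0.
case: n => [|n]; first by rewrite big_pred0.
by rewrite big_mkcond big_ord_recl /= IHns [in LHS]big_mkcond.
Qed.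

Definition betas_vanish (K : fieldType) (alpha : 'S_m -> K) r : Prop :=
  forall k, (k < r)%N ->
  forall (h : 'I_k -> nat) (T : 'I_k -> {set 'I_m}) (t : 'I_k -> 'I_m),
    admissible h T t -> beta alpha h T t = 0.

Lemma beta_matches (K : fieldType) (alpha : 'S_m -> K) r bs :
  betas_vanish alpha r -> (size bs < r)%N ->
  \sum_(s | matches bs (word_of s)) alpha s = 0.
Proof.
move=> vanish ltr.
have [s0 /= s0P|no_s] := pickP [pred s | matches bs (word_of s)]; last first.
  exact: big_pred0.
pose b i := tnth (in_tuple bs) i.
pose h i := (b i).1.1.+1; pose T i := (b i).1.2; pose t i := (b i).2.
have onth_bs (i : 'I_(size bs)) : onth bs i = Some ((b i).1.1, T i, t i).
  rewrite onthE (nth_map (b i)) //.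
  rewrite -[nth _ _ _](tnth_nth _ (in_tuple bs)) -/(b i).
  by rewrite /T /t; case: (b i) => -[].
have boundE n : block_bound h n = sumn (take n (block_sizes bs)).
  rewrite sumn_take size_map; apply: eq_bigr => j _.
  by rewrite (nth_map (b j)) // -[nth _ _ _](tnth_nth _ (in_tuple bs)).
have sum_h : (\sum_i h i <= m)%N.
  rewrite -block_bound_full boundE take_oversize ?size_map //.
  by rewrite (leq_trans (matches_size s0P)) // size_map size_enum_ord.
have matchesE s : matches bs (word_of s) = (s \in perms_of h T t).
  rewrite [RHS]inE; apply/matchesP/forallP => [Hbs i|Hs i p T' t' bs_i v].
    have [TE /eqP tE] := Hbs i _ _ _ (onth_bs i); move: TE tE.
    rewrite take_drop_word_of onth_word_of -boundE => -> /andP[_ ->].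
    by rewrite eqxx.
  have lti : (i < size bs)%N by rewrite -onthTE bs_i.
  have := Hs (Ordinal lti).
  move: bs_i; rewrite (onth_bs (Ordinal lti)) => -[<- <- <-].
  rewrite {}/v take_drop_word_of -boundE => /andP[/eqP TE tE]; split=> //.
  apply/eqP; rewrite onth_word_of tE andbT.
  rewrite (leq_trans _ sum_h) // -block_bound_full -addnS.
  by rewrite -(block_boundS h (Ordinal lti)) leq_block_bound.
rewrite (eq_bigl _ _ matchesE); apply: vanish => //.
by apply: (perms_of_admissible (s := s0)) sum_h _ => //; rewrite -matchesE.
Qed.

Lemma multilin_Tideal (K : fieldType) (alpha : 'S_m -> K) r :
  betas_vanish alpha r -> Tideal_gen (eq (commprod K r)) (multilin alpha).
Proof.
move=> vanish J J_Tideal /(_ _ erefl) Jc.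
have J_ideal : is_ideal (R := free_algType K) J by case: J_Tideal.
pose x (p : 'I_m) : free_algType K := var K p.
have absorbs1 := absorbs_commprod J_Tideal Jc.
have := @absorbs_words _ _ (free_algType K) J J_ideal x _ alpha r 1
          setT xpredT word_of absorbs1.
rewrite mul1r.
have -> : \sum_s alpha s *: \prod_(y <- word_of s) x y = multilin alpha.
  by apply: eq_bigr => s _; rewrite /word_of big_map [index_enum _]unlock -enumT.
apply=> [s _|bs ltbs]; last by exact: beta_matches vanish ltbs.
apply: uniq_perm; rewrite ?(map_inj_uniq perm_inj) ?enum_uniq // => y.
by rewrite mem_enum inE -[y](permKV s) (mem_map perm_inj) mem_enum.
Qed.

End MatchesPermutations.

Theorem theorem3p7 (K : fieldType) (hK : infinite_type K)
    (m : nat) (alpha : 'S_m -> K) (r : nat) (hr : (1 <= r)%N) :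
  [<-> commutator_degree (multilin alpha) r;
       Id (UT K r) (multilin alpha) /\ ~ Id (UT K r.+1) (multilin alpha);
       (forall (k : nat), (k < r)%N ->
          forall (h : 'I_k -> nat) (T : 'I_k -> {set 'I_m}) (t : 'I_k -> 'I_m),
            admissible h T t -> beta alpha h T t = 0%R)
       /\ (exists (h : 'I_r -> nat) (T : 'I_r -> {set 'I_m}) (t : 'I_r -> 'I_m),
            admissible h T t /\ beta alpha h T t <> 0%R)].
Proof.
have Id_of_Tideal q : (0 < q)%N ->
    Tideal_gen (eq (commprod K q)) (multilin alpha) ->
    Id (UT K q) (multilin alpha).
  exact: Tideal_commprod_Id.
have vanish_of_Id q : Id (UT K q) (multilin alpha) -> betas_vanish alpha q.
  by move=> fId k ltkq h T t adm; exact: Id_beta_eq0 fId.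
have Tideal_of_vanish q : betas_vanish alpha q ->
    Tideal_gen (eq (commprod K q)) (multilin alpha).
  exact (@multilin_Tideal m K alpha q).
tfae.
- move=> [_ fT f'T]; split; first exact: Id_of_Tideal.
  by move=> /vanish_of_Id/Tideal_of_vanish.
- move=> [/vanish_of_Id vanish f'Id]; split=> //; apply: NNPP => no_beta.
  have vanish' : betas_vanish alpha r.+1.
    move=> k; rewrite ltnS leq_eqVlt.
    case/orP => [/eqP eq_kr h T t adm|]; last exact: vanish.
    subst k; apply: NNPP => beta_neq0; apply: no_beta.
    by exists h, T, t.
  exact: f'Id (Id_of_Tideal r.+1 isT (Tideal_of_vanish r.+1 vanish')).
move=> [vanish [h [T [t [adm beta_neq0]]]]]; split=> //.
  exact (Tideal_of_vanish r vanish).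
move=> /(Id_of_Tideal r.+1 isT)/vanish_of_Id vanish'.
exact/beta_neq0/vanish'.
Qed.
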